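(* Let $\triangle$ be a simplicial complex on a finite vertex set $V$ and let $M_\triangle$ be its simplicial binoid with generators $x_v$, $v\in V$. For any face $F\in\triangle$ put $x_F=\sum_{v\in F}x_v$. Then there is an isomorphism of binoids $$(M_\triangle)_{x_F}\cong M_{\triangle'}\wedge(\mathbb Z^F)^\infty,$$ where $\triangle'=\operatorname{lk}_\triangle(F)$ is the link of $F$ in $\triangle$.
   Context: A binoid $(M,+,0,\infty)$ is a commutative monoid with an absorbing element $\infty$. For a monoid $A$, $A^\infty=A\cup\{\infty\}$ is the binoid obtained by adjoining an absorbing element. For $f\in M$, $M_f$ denotes the localization of $M$ at $f$ (formally inverting $f$). The smash product $M\wedge N$ of binoids is the quotient of $M\times N$ identifying all pairs $(a,b)$ with $a=\infty$ or $b=\infty$ to a single absorbing element $\infty$, with componentwise addition (it is the coproduct of commutative binoids). A simplicial complex $\triangle$ on $V$ is a set of subsets of $V$ (faces) closed under taking subsets; $\triangle$ is assumed to contain all singletons of $V$. $M_\triangle$ is the commutative binoid generated by $x_v$, $v\in V$, with relations $\sum_{v\in H}x_v=\infty$ for all $H\subseteq V$ with $H\notin\triangle$. The link $\operatorname{lk}_\triangle(F)$ is the simplicial complex on $V\setminus F$ consisting of all $G\subseteq V\setminus F$ with $F\cup G\in\triangle$ (some singletons of $V\setminus F$ may fail to be faces of the link; the corresponding generators are then equal to $\infty$ in $M_{\operatorname{lk}_\triangle(F)}$). *)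

(* Defs.v *)
From HB Require Import structures.
From mathcomp Require Import all_boot all_order all_algebra.
From mathcomp Require Import generic_quotient.
From mathcomp Require Import boolp.

Set Implicit Arguments.
Unset Strict Implicit.
Unset Printing Implicit Defensive.

Import GRing.Theory.
Local Open Scope ring_scope.
Local Open Scope quotient_scope.

(* 0 = infty is allowed: this is the zero binoid, for instance M_f for a
   nilpotent f. *)
HB.mixin Record Nmodule_isBinoid M of GRing.Nmodule M := {
  infty : M;
  addInfty : forall x : M, infty + x = infty
}.

#[short(type="binoidType")]
HB.structure Definition Binoid :=
  {M of Nmodule_isBinoid M & GRing.Nmodule M}.

Arguments infty {s}.

(* {additive M -> N} is the type of maps preserving 0 and +. *)
Definition binoid_isomorphic (M N : binoidType) : Prop :=
  exists f : {additive M -> N}, f infty = infty /\ bijective f.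

Record congruence (M : nmodType) := Congruence {
  congr_rel :> M -> M -> Prop;
  congr_refl : forall a, congr_rel a a;
  congr_sym : forall a b, congr_rel a b -> congr_rel b a;
  congr_trans : forall a b c,
    congr_rel a b -> congr_rel b c -> congr_rel a c;
  congr_add : forall a b c, congr_rel a b -> congr_rel (a + c) (b + c)
}.

Section CongruenceQuotient.
Variables (M : nmodType) (c : congruence M).

Definition congrb : rel M := fun a b => `[< c a b >].

Lemma congrb_refl : reflexive congrb.
Proof. by move=> a; apply/asboolP; apply: congr_refl. Qed.

Lemma congrb_sym : symmetric congrb.
Proof. by move=> a b; apply/asboolP/asboolP; apply: congr_sym. Qed.

Lemma congrb_trans : transitive congrb.
Proof.
by move=> b a d /asboolP ab /asboolP bd; apply/asboolP; apply: congr_trans bd.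
Qed.

Canonical congrb_equiv : equiv_rel M :=
  EquivRel congrb congrb_refl congrb_sym congrb_trans.

Definition congr_quot : Type := {eq_quot congrb_equiv}.

HB.instance Definition _ := Choice.on congr_quot.
HB.instance Definition _ := EqQuotient.on congr_quot.

Lemma congr_quotP (a b : M) :
  reflect (c a b) (\pi_congr_quot a == \pi_congr_quot b).
Proof. by rewrite piE; apply: asboolP. Qed.

Definition congr_quot_zero : congr_quot := \pi_congr_quot 0.

Definition congr_quot_add : congr_quot -> congr_quot -> congr_quot :=
  lift_op2 congr_quot +%R.

Lemma congr_quot_addE :
  {morph \pi_congr_quot : a b / a + b >-> congr_quot_add a b}.
Proof.
have reprP (d : M) : c (repr (\pi_congr_quot d)) d.
  by apply/congr_quotP; rewrite reprK.
move=> a b; unlock congr_quot_add; apply/eqP/congr_quotP/congr_sym.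
apply: (congr_trans (congr_add _ (reprP a))).
by rewrite addrC (addrC a); apply/congr_add/reprP.
Qed.

Lemma congr_quot_addA : associative congr_quot_add.
Proof.
move=> x y z; rewrite -[x]reprK -[y]reprK -[z]reprK.
by rewrite -!congr_quot_addE addrA.
Qed.

Lemma congr_quot_addC : commutative congr_quot_add.
Proof.
by move=> x y; rewrite -[x]reprK -[y]reprK -!congr_quot_addE addrC.
Qed.

Lemma congr_quot_add0 : left_id congr_quot_zero congr_quot_add.
Proof. by move=> x; rewrite -[x]reprK -congr_quot_addE add0r. Qed.

HB.instance Definition _ := GRing.isNmodule.Build congr_quot
  congr_quot_addA congr_quot_addC congr_quot_add0.

Lemma pi_congr_quotD (a b : M) :
  \pi_congr_quot (a + b) = \pi_congr_quot a + \pi_congr_quot b.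
Proof. exact: congr_quot_addE. Qed.

End CongruenceQuotient.

Section BinoidQuotient.
Variables (M : binoidType) (c : congruence M).

Lemma congr_quot_inftyP (x : congr_quot c) :
  \pi_(congr_quot c) (infty : M) + x = \pi_(congr_quot c) (infty : M).
Proof. by rewrite -[x]reprK -pi_congr_quotD addInfty. Qed.

HB.instance Definition _ :=
  Nmodule_isBinoid.Build (congr_quot c) congr_quot_inftyP.

End BinoidQuotient.

Section GeneratedCongruence.
Variables (M : nmodType) (R : M -> M -> Prop).

Inductive gen_rel : M -> M -> Prop :=
| gen_step a b : R a b -> gen_rel a b
| gen_refl a : gen_rel a a
| gen_sym a b : gen_rel a b -> gen_rel b a
| gen_trans a b d : gen_rel a b -> gen_rel b d -> gen_rel a d
| gen_add a b d : gen_rel a b -> gen_rel (a + d) (b + d).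

Definition gen_congruence : congruence M :=
  Congruence gen_refl gen_sym gen_trans gen_add.

End GeneratedCongruence.

Definition adjoin_infty (A : Type) : Type := option A.

Section AdjoinInfty.
Variable A : nmodType.

HB.instance Definition _ := Choice.copy (adjoin_infty A) (option A).

Definition adjoin_add (x y : adjoin_infty A) : adjoin_infty A :=
  if x is Some a then if y is Some b then Some (a + b) else None else None.

Lemma adjoin_addA : associative adjoin_add.
Proof. by move=> [a|] [b|] [d|] //=; rewrite addrA. Qed.

Lemma adjoin_addC : commutative adjoin_add.
Proof. by move=> [a|] [b|] //=; rewrite addrC. Qed.

Lemma adjoin_add0 : left_id (Some 0 : adjoin_infty A) adjoin_add.
Proof. by move=> [a|] //=; rewrite add0r. Qed.

HB.instance Definition _ := GRing.isNmodule.Build (adjoin_infty A)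
  adjoin_addA adjoin_addC adjoin_add0.

Lemma adjoin_inftyP (x : adjoin_infty A) :
  (None : adjoin_infty A) + x = None.
Proof. by []. Qed.

HB.instance Definition _ :=
  Nmodule_isBinoid.Build (adjoin_infty A) adjoin_inftyP.

End AdjoinInfty.

Section Localization.
Variables (M : binoidType) (f : M).

(* The pair (a, n) stands for the formal difference a - n f. *)
Definition loc_rel (p q : (M * nat)%type) : Prop :=
  exists k : nat, p.1 + f *+ (k + q.2) = q.1 + f *+ (k + p.2).

Lemma loc_rel_refl p : loc_rel p p.
Proof. by exists 0%N. Qed.

Lemma loc_rel_sym p q : loc_rel p q -> loc_rel q p.
Proof. by case=> k e; exists k; rewrite e. Qed.

Lemma loc_rel_trans p q r : loc_rel p q -> loc_rel q r -> loc_rel p r.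
Proof.
case: p q r => [a n] [b m] [d l] [k /= e] [j /= e'].
exists (k + j + m)%N => /=.
have -> : (k + j + m + l = (k + m) + (j + l))%N by rewrite -addnA addnACA.
rewrite mulrnDr addrA e addrAC e' -addrA -mulrnDr; congr (_ + f *+ _).
by rewrite addnACA (addnC j) addnA.
Qed.

Lemma loc_rel_add p q r : loc_rel p q -> loc_rel (p + r) (q + r).
Proof.
case: p q r => [a n] [b m] [d l] [k /= e]; exists k => /=.
by rewrite !addnA !mulrnDr !addrA !(addrAC _ d) -!(addrA _ (f *+ k)) -!mulrnDr e.
Qed.

Definition loc_congruence : congruence (M * nat)%type :=
  Congruence loc_rel_refl loc_rel_sym loc_rel_trans loc_rel_add.

Definition localization : Type := congr_quot loc_congruence.

HB.instance Definition _ := GRing.Nmodule.on localization.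

Definition loc_infty : localization :=
  \pi_(congr_quot loc_congruence) ((infty : M), 0%N).

Lemma loc_inftyP (x : localization) : loc_infty + x = loc_infty.
Proof.
rewrite -[x](@reprK _ (congr_quot loc_congruence)) -[LHS]pi_congr_quotD.
by apply/eqP/congr_quotP; exists 0%N; rewrite /= !addInfty.
Qed.

HB.instance Definition _ := Nmodule_isBinoid.Build localization loc_inftyP.

End Localization.

Section Smash.
Variables M N : binoidType.

Definition has_infty (p : (M * N)%type) : Prop :=
  p.1 = infty \/ p.2 = infty.

Definition smash_rel (p q : (M * N)%type) : Prop :=
  p = q \/ has_infty p /\ has_infty q.

Lemma has_infty_add p q : has_infty p -> has_infty (p + q).
Proof. by case=> /= e; [left|right]; rewrite /= e addInfty. Qed.

Lemma smash_rel_refl p : smash_rel p p.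
Proof. by left. Qed.

Lemma smash_rel_sym p q : smash_rel p q -> smash_rel q p.
Proof. by case=> [->|[hp hq]]; [left|right]. Qed.

Lemma smash_rel_trans p q r : smash_rel p q -> smash_rel q r -> smash_rel p r.
Proof.
case=> [->//|[hp hq]] [<-|[_ hr]]; first by right.
by right.
Qed.

Lemma smash_rel_add p q r : smash_rel p q -> smash_rel (p + r) (q + r).
Proof.
by case=> [->|[hp hq]]; [left|right; split; apply: has_infty_add].
Qed.

Definition smash_congruence : congruence (M * N)%type :=
  Congruence smash_rel_refl smash_rel_sym smash_rel_trans smash_rel_add.

Definition smash : Type := congr_quot smash_congruence.

HB.instance Definition _ := GRing.Nmodule.on smash.

Definition smash_infty : smash :=
  \pi_(congr_quot smash_congruence) ((infty : M), (infty : N)).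

Lemma smash_inftyP (x : smash) : smash_infty + x = smash_infty.
Proof.
rewrite -[x](@reprK _ (congr_quot smash_congruence)) -[LHS]pi_congr_quotD.
by apply/eqP/congr_quotP; right; split; left; rewrite /= ?addInfty.
Qed.

HB.instance Definition _ := Nmodule_isBinoid.Build smash smash_inftyP.

End Smash.

(* Singletons are not required to be faces, so that links are covered. *)
Record simplicial_complex (V : finType) := SimplicialComplex {
  faces :> {set {set V}};
  faces_down : forall G H : {set V}, G \subset H -> H \in faces -> G \in faces
}.

Section SimplicialBinoid.
Variable V : finType.

(* The free commutative binoid on V is (N^V)^infty. *)
Definition free_binoid : Type := adjoin_infty {ffun V -> nat}.

HB.instance Definition _ := Binoid.on free_binoid.

Definition free_gen (v : V) : free_binoid :=
  Some [ffun w => (w == v : nat)].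

Variable D : simplicial_complex V.

Definition nonface_rel (a b : free_binoid) : Prop :=
  exists2 H : {set V}, H \notin faces D &
    a = \sum_(v in H) free_gen v /\ b = infty.

Definition simplicial_binoid : Type :=
  congr_quot (gen_congruence nonface_rel).

HB.instance Definition _ := Binoid.on simplicial_binoid.

Definition simplicial_gen (v : V) : simplicial_binoid :=
  \pi_(congr_quot (gen_congruence nonface_rel)) (free_gen v).

End SimplicialBinoid.

Section Link.
Variables (V : finType) (D : simplicial_complex V) (F : {set V}).

Definition link_faces : {set {set {v : V | v \notin F}}} :=
  [set G : {set {v : V | v \notin F}} |
    F :|: [set val v | v in G] \in faces D].

Lemma link_faces_down (G H : {set {v : V | v \notin F}}) :
  G \subset H -> H \in link_faces -> G \in link_faces.
Proof.
move=> sGH; rewrite !inE; apply: faces_down.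
exact: setUS (imsetS _ sGH).
Qed.

Definition link : simplicial_complex {v : V | v \notin F} :=
  SimplicialComplex link_faces_down.

End Link.

(* Main.v *)
(** A monomial [x^a] of [M_D] is [infty] exactly when [supp a] is not a face.
    Both sides are quotients of [free V * nat], where [(a, n)] stands for
    [x^a - n x_F].  On each side [(a, n)] becomes [infty] exactly when
    [F :|: supp a] is not a face, and otherwise its class is determined by the
    integer vector [a - n 1_F].  Hence both quotients have the same kernel. *)
Require Import Defs.
From HB Require Import structures.
From mathcomp Require Import all_boot all_order all_algebra.
From mathcomp Require Import generic_quotient boolp zify.

Set Implicit Arguments.
Unset Strict Implicit.
Unset Printing Implicit Defensive.

Import GRing.Theory.
Local Open Scope ring_scope.

(** The map [f] is [q] after a choice [s] of preimages under [p]. As the kernels agree, the choice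
    does not affect the value, which yields additivity and the inverse. *)
Lemma binoid_isomorphic_same_kernel (A : nmodType) (M N : binoidType)
    (p : A -> M) (q : A -> N) :
  Algebra.nmod_morphism p -> nmod_morphism q ->
  (forall x, exists a, p a = x) -> (forall y, exists a, q a = y) ->
  (forall a b, p a = p b <-> q a = q b) -> binoid_isomorphic M N.
Proof.
move=> [p0 pD] [q0 qD] p_surj q_surj pq.
pose s x := sval (cid (p_surj x)); pose t y := sval (cid (q_surj y)).
have sK x : p (s x) = x by rewrite /s; case: cid.
have tK y : q (t y) = y by rewrite /t; case: cid.
have f_morph : Algebra.nmod_morphism (fun x => q (s x)).
  by split=> [|x y]; rewrite -1?q0 -?qD; apply/pq; rewrite ?pD !sK.
pose f : {additive M -> N} := HB.pack (fun x => q (s x))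
  (GRing.isNmodMorphism.Build M N (fun x => q (s x)) f_morph).
have gfK : cancel f (fun y => p (t y)).
  by move=> x; rewrite -[RHS]sK; apply/pq; rewrite tK.
have fgK : cancel (fun y => p (t y)) f.
  by move=> y; rewrite -[RHS]tK; apply/pq; rewrite sK.
exists f; split; last by exists (fun y => p (t y)).
(* A surjective additive map preserves the absorbing element: writing [infty] as [f z], the sum
   [f infty + f z = f (infty + z)] equals both [infty] and [f infty]. *)
rewrite -[RHS](addInfty (f infty)) [RHS]addrC.
rewrite -[X in _ = _ + X](fgK infty) -raddfD.
by rewrite addInfty.
Qed.

Lemma pi_congr_quot_eq (M : nmodType) (c : congruence M) (a b : M) :
  \pi_(congr_quot c)%qT a = \pi_(congr_quot c)%qT b <-> c a b.
Proof.
by split=> [e|ab]; [apply/congr_quotP/eqP | apply/eqP/congr_quotP].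
Qed.

(** * Supports and squarefree monomials *)

Section MonomialSupport.
Variable V : finType.
Implicit Types (a b : {ffun V -> nat}) (G H : {set V}).

Definition supp a : {set V} := [set v | a v != 0%N].

Definition indicator H : {ffun V -> nat} := [ffun v => (v \in H : nat)].

Lemma supp_add a b : supp (a + b) = supp a :|: supp b.
Proof. by apply/setP=> v; rewrite !inE ffunE addn_eq0 negb_and. Qed.

Lemma supp_indicator H : supp (indicator H) = H.
Proof. by apply/setP=> v; rewrite inE ffunE; case: (v \in H). Qed.

Lemma indicatorMn H k v : (indicator H *+ k) v = (k * (v \in H))%N.
Proof. by elim: k => [|k IHk]; rewrite ?mulrS ffunE // IHk ffunE mulSn. Qed.

Lemma sum_free_gen H :
  \sum_(v in H) free_gen v = Some (indicator H) :> free_binoid V.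
Proof.
have SomeD : {morph (Some : {ffun V -> nat} -> free_binoid V) : a b / a + b}.
  by [].
rewrite -(big_morph _ SomeD (erefl (Some 0 : free_binoid V))); congr Some.
apply/ffunP=> w; rewrite sum_ffunE ffunE.
under eq_bigr => v _ do rewrite ffunE.
rewrite big_mkcond /= (bigD1 w) //= eqxx big1 ?addr0; first by case: (w \in H).
by move=> v /negbTE; rewrite eq_sym => ->; case: ifP.
Qed.

End MonomialSupport.

(** * Normal forms in a simplicial binoid *)

Section SimplicialNormalForm.
Variables (V : finType) (D : simplicial_complex V).
Implicit Types (x y : free_binoid V) (a b : {ffun V -> nat}).

Definition normal_form x : free_binoid V :=
  if x is Some a then if supp a \in faces D then Some a else None else None.

(** Supports only grow under addition and nonfaces are closed under supersets. Hence having equal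
    normal forms is a congruence, as the induction in [gen_relP] requires. *)
Lemma normal_form_addl x y :
  normal_form (normal_form x + y) = normal_form (x + y).
Proof.
case: x y => [a|] [b|] //=; case: ifPn => //= /negP aD; try by [].
rewrite ifN //; apply/negP; apply: contra_not aD; apply: faces_down.
by rewrite supp_add subsetUl.
Qed.

Lemma gen_rel_normal_form x : gen_rel (nonface_rel D) x (normal_form x).
Proof.
case: x => [a|] /=; last exact: gen_refl.
case: ifPn => [_|aD]; first exact: gen_refl.
(* Split off the squarefree part of the monomial: for a nonface [supp a] it is a defining relation,
   and it absorbs the cofactor [b]. *)
pose b : {ffun V -> nat} := [ffun v => a v - (v \in supp a)]%N.
have -> : a = indicator (supp a) + b.
  by apply/ffunP=> v; rewrite !ffunE inE; case: (a v) => //= n; rewrite subn1.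
have: gen_rel (nonface_rel D) (Some (indicator (supp a))) infty.
  by apply: gen_step; exists (supp a); rewrite ?sum_free_gen.
exact: gen_add (Some b : free_binoid V).
Qed.

Lemma gen_relP x y :
  gen_rel (nonface_rel D) x y <-> normal_form x = normal_form y.
Proof.
split=> [|e]; last first.
  apply: gen_trans (gen_rel_normal_form x) _; rewrite e.
  exact/gen_sym/gen_rel_normal_form.
elim=> {x y} [_ _ [H HD [-> ->]]|//|//|x y z _ -> _ ->//|x y z _ e].
  by rewrite sum_free_gen /= supp_indicator (negbTE HD).
by rewrite -normal_form_addl e normal_form_addl.
Qed.

Definition monomial x : simplicial_binoid D :=
  \pi_(congr_quot (gen_congruence (nonface_rel D)))%qT x.

Lemma monomial_eq x y :
  monomial x = monomial y <-> normal_form x = normal_form y.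
Proof. by rewrite -gen_relP; apply: (pi_congr_quot_eq (gen_congruence _)). Qed.

Lemma monomialD : {morph monomial : x y / x + y}.
Proof. exact: pi_congr_quotD. Qed.

Lemma monomial0 : monomial 0 = 0.
Proof. by []. Qed.

Lemma monomialMn x n : monomial (x *+ n) = monomial x *+ n.
Proof. by elim: n => [|n IHn] //; rewrite !mulrS monomialD IHn. Qed.

Lemma monomial_surj z : exists x, monomial x = z.
Proof. by exists (repr z); rewrite /monomial reprK. Qed.

Lemma sum_simplicial_gen (H : {set V}) :
  \sum_(v in H) simplicial_gen D v = monomial (Some (indicator H)).
Proof. by rewrite -sum_free_gen (big_morph _ monomialD monomial0). Qed.

End SimplicialNormalForm.

(** * The localization side *)

Section LinkLocalization.
Variables (V : finType) (D : simplicial_complex V) (F : {set V}).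
Implicit Types (p q : (free_binoid V * nat)%type) (a b : {ffun V -> nat}).

Local Notation xF := (\sum_(v in F) simplicial_gen D v).
Local Notation ZF := (adjoin_infty {ffun {v : V | v \in F} -> int}).
Local Notation Mlink := (simplicial_binoid (link D F)).

(** [F] is joined to the support because a monomial dies in the localization as soon as adding some
    multiple of [xF] makes it [infty]. *)
Definition loc_normal_form p : option {ffun V -> int} :=
  if p.1 is Some a then
    if F :|: supp a \in faces D
    then Some [ffun v => (a v)%:Z - (p.2 * (v \in F))%:Z] else None
  else None.

Definition to_loc p : localization xF :=
  \pi_(congr_quot (loc_congruence xF))%qT (monomial D p.1, p.2).

Lemma to_loc_morph : Algebra.nmod_morphism to_loc.
Proof.
split=> // p q; rewrite /to_loc /= monomialD.
exact: (pi_congr_quotD (loc_congruence xF) (monomial D p.1, p.2)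
                                            (monomial D q.1, q.2)).
Qed.

Lemma to_loc_surj z : exists p, to_loc p = z.
Proof.
have [x xE] := monomial_surj (repr z).1.
by exists (x, (repr z).2); rewrite /to_loc xE -surjective_pairing reprK.
Qed.

Lemma SomeMn a n : (Some a : free_binoid V) *+ n = Some (a *+ n).
Proof. by elim: n => // n IHn; rewrite !mulrS IHn. Qed.

(** The successor ensures at least one copy of [indicator F], so the support is independent of [k]
    and [m]. *)
Lemma supp_addMn a k m :
  supp (a + indicator F *+ (k.+1 + m)) = F :|: supp a.
Proof.
rewrite addSn supp_add setUC; congr (_ :|: _).
by apply/setP=> v; rewrite inE indicatorMn; case: (v \in F);
  rewrite ?muln1 ?muln0.
Qed.

Lemma to_loc_eq p q :
  to_loc p = to_loc q <-> loc_normal_form p = loc_normal_form q.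
Proof.
(* The witness [k] of [loc_rel] may be replaced by [k.+1], adding [xF] once more to both sides; then
   [supp_addMn] applies. *)
have -> : to_loc p = to_loc q <-> exists k, normal_form D
    (p.1 + Some (indicator F *+ (k.+1 + q.2)))
    = normal_form D (q.1 + Some (indicator F *+ (k.+1 + p.2))).
  have relE k : monomial D p.1 + xF *+ (k + q.2)
      = monomial D q.1 + xF *+ (k + p.2) <->
      normal_form D (p.1 + Some (indicator F *+ (k + q.2)))
      = normal_form D (q.1 + Some (indicator F *+ (k + p.2))).
    by rewrite sum_simplicial_gen -!monomialMn -!monomialD !SomeMn monomial_eq.
  split=> [e|[k /relE e]]; last first.
    by apply/(pi_congr_quot_eq (loc_congruence xF)); exists k.+1.
  have [k /= {}e] : loc_rel xF (monomial D p.1, p.2) (monomial D q.1, q.2).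
    exact/(pi_congr_quot_eq (loc_congruence xF)).
  exists k; apply/relE; rewrite !addSn !mulrSr !addrA; congr (_ + _).
  exact: e.
case: p q => [[a|] n] [[b|] m]; rewrite /loc_normal_form /= ?adjoin_inftyP /=.
- setoid_rewrite supp_addMn.
  (* Over the integers the [k.+1] common copies cancel, leaving a condition free of [k]; so the
     witness 0 suffices for the converse. *)
  have coefE k : a + indicator F *+ (k.+1 + m) = b + indicator F *+ (k.+1 + n)
      <-> [ffun v => (a v)%:Z - (n * (v \in F))%:Z]
          = [ffun v => (b v)%:Z - (m * (v \in F))%:Z] :> {ffun V -> int}.
    have subE (x y i j : nat) (c : bool) :
        (x + (k.+1 + j) * c = y + (k.+1 + i) * c)%N
        <-> x%:Z - (i * c)%:Z = y%:Z - (j * c)%:Z by case: c; lia.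
    split=> /ffunP e; apply/ffunP=> v; move: (e v); rewrite !ffunE !indicatorMn.
      exact: (subE _ _ _ _ _).1.
    exact: (subE _ _ _ _ _).2.
  split=> [[k]|e].
    case: ifP => // _; case: ifP => // _ [e].
    by congr Some; apply/(coefE k).
  exists 0%N; move: e; case: ifP => // _; case: ifP => // _ [e].
  by congr Some; apply/(coefE 0%N).
- setoid_rewrite supp_addMn; split=> [[k]|]; first by case: ifP.
  by move=> e; exists 0%N; move: e; case: ifP.
- setoid_rewrite supp_addMn; split=> [[k]|]; first by case: ifP.
  by move=> e; exists 0%N; move: e; case: ifP.
- by split=> // _; exists 0%N.
Qed.

(** * The smash product side: coordinates outside and inside F *)

Definition restr (x : free_binoid V) : free_binoid {v : V | v \notin F} :=
  if x is Some a then Some [ffun v => a (val v)] else None.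

Lemma restrD : {morph restr : x y / x + y}.
Proof.
by move=> [a|] [b|] //; congr Some; apply/ffunP=> v; rewrite !ffunE.
Qed.

Definition exponent p : ZF :=
  if p.1 is Some a then Some [ffun v => (a (val v))%:Z - p.2%:Z] else None.

Lemma exponentD : {morph exponent : p q / p + q}.
Proof.
move=> [[a|] n] [[b|] m] //; congr Some; apply/ffunP=> v; rewrite !ffunE /=.
by rewrite !PoszD opprD addrACA.
Qed.

Definition to_smash p : smash Mlink ZF :=
  \pi_(congr_quot (smash_congruence Mlink ZF))%qT
    (monomial (link D F) (restr p.1), exponent p).

Lemma to_smash_morph : Algebra.nmod_morphism to_smash.
Proof.
split=> [|p q]; rewrite /to_smash.
  have -> : restr (0 : free_binoid V * nat).1 = 0.
    by congr Some; apply/ffunP=> v; rewrite !ffunE.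
  have -> : exponent 0 = 0 by congr Some; apply/ffunP=> v; rewrite !ffunE.
  by [].
rewrite exponentD restrD monomialD.
exact: (pi_congr_quotD (smash_congruence Mlink ZF)
  (monomial (link D F) (restr p.1), exponent p)
  (monomial (link D F) (restr q.1), exponent q)).
Qed.

Lemma to_smash_surj z : exists p, to_smash p = z.
Proof.
have -> : z = \pi_(congr_quot (smash_congruence Mlink ZF))%qT (repr z).
  by rewrite reprK.
case: (repr z) => y e; have [x <-] := monomial_surj y.
have infE (x' : free_binoid {v : V | v \notin F}) e' :
    x' = None \/ e' = None -> to_smash (None, 0%N) =
    \pi_(congr_quot (smash_congruence Mlink ZF))%qT
      (monomial (link D F) x', e').
  move=> inf; apply/(pi_congr_quot_eq (smash_congruence Mlink ZF)); right.
  by split; [left | case: inf => ->; [left|right]].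
case: x e => [c|] [e|]; do ?[by exists (None, 0%N); apply: infE; tauto].
(* A common denominator, large enough to make every coordinate of [e] nonnegative after adding
   [n]. *)
pose n := (\sum_v `|e v|)%N.
have e_ge v : 0 <= e v + n%:Z.
  have : (`|e v| <= n)%N by rewrite /n (bigD1 v) //= leq_addr.
  by lia.
(* Glue [e + n] on [F] with [c] off [F]. By [e_ge] the absolute value changes nothing, and the final
   default 0 is never reached. *)
pose a : {ffun V -> nat} := [ffun v =>
  if (insub v : option {v : V | v \in F}) is Some w then absz (e w + n%:Z)
  else if (insub v : option {v : V | v \notin F}) is Some w then c w else 0%N].
exists (Some a, n); rewrite /to_smash.
have -> : restr (Some a) = Some c.
  congr Some; apply/ffunP=> v; rewrite !ffunE insubF ?valK //.
  exact: negbTE (valP v).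
have -> // : exponent (Some a, n) = Some e.
by congr Some; apply/ffunP=> v; rewrite !ffunE valK gez0_abs // addrK.
Qed.

(** Joining [F] restores whatever part of the support the restriction has discarded. *)
Lemma supp_restr_link a :
  (supp [ffun v : {v : V | v \notin F} => a (val v)] \in faces (link D F))
  = (F :|: supp a \in faces D).
Proof.
pose c : {ffun {v : V | v \notin F} -> nat} := [ffun v => a (val v)].
rewrite inE -/c; have -> // : F :|: [set val v | v in supp c] = F :|: supp a.
apply/setP=> v; rewrite !inE.
case: (boolP (v \in F)) => //= vF; apply/imsetP/idP => [[w]|av].
  by rewrite inE ffunE => ? ->.
by exists (exist _ v vF) => //; rewrite inE ffunE.
Qed.

(** The exponent is infinite only when [p.1] is, so the link component alone decides. *)
Lemma has_infty_to_smash p :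
  has_infty (monomial (link D F) (restr p.1), exponent p)
  <-> loc_normal_form p = None.
Proof.
rewrite /has_infty /= -[infty]/(monomial (link D F) None) monomial_eq.
case: p => [[a|] n]; rewrite /exponent /loc_normal_form /=; last by split; auto.
by rewrite supp_restr_link; case: ifP => _; split=> //; [case|left].
Qed.

Lemma to_smash_eq p q :
  to_smash p = to_smash q <-> loc_normal_form p = loc_normal_form q.
Proof.
rewrite (pi_congr_quot_eq (smash_congruence Mlink ZF)) /= /smash_rel.
rewrite !has_infty_to_smash.
split=> [[]|]; last 1 first.
(* Two infinite pairs are identified by the smash relation; for finite ones, reading the integer
   vector off [F] and on [F] recovers both components. *)
- case ep : (loc_normal_form p) => [s|] e; last by right.
  left; move: ep e; case: p q => [[a|] n] [[b|] m] //.
  rewrite /loc_normal_form /exponent /=; case: ifP => // _ [<-].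
  case: ifP => // _ [/ffunP e]; congr (monomial _ (Some _), Some _).
    apply/ffunP=> v; have := e (val v).
    by rewrite !ffunE (negbTE (valP v)) !muln0 !subr0 => -[].
  by apply/ffunP=> v; have := e (val v); rewrite !ffunE (valP v) !muln1.
- case=> /monomial_eq.
  case: p q => [[a|] n] [[b|] m] //; rewrite /loc_normal_form /exponent /=.
  rewrite !supp_restr_link.
  case: ifP => _; case: ifP => // _ [/ffunP eo] [/ffunP ei].
  congr Some; apply/ffunP=> v; rewrite !ffunE.
  (* On [F] the coordinate comes from the exponent, elsewhere from the link monomial. *)
  case: (boolP (v \in F)) => vF.
    by have := ei (exist _ v vF); rewrite !ffunE /= !muln1.
  by have := eo (exist _ v vF); rewrite !ffunE /= !muln0 => ->.
- by case=> -> ->.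
Qed.

End LinkLocalization.

Theorem theorem2p15 (V : finType) (D : simplicial_complex V)
    (D_vertices : forall v : V, [set v] \in faces D)
    (F : {set V}) (F_face : F \in faces D) :
  binoid_isomorphic
    (localization (\sum_(v in F) simplicial_gen D v))
    (smash (simplicial_binoid (link D F))
           (adjoin_infty {ffun {v : V | v \in F} -> int})).
Proof.
apply: (binoid_isomorphic_same_kernel (to_loc_morph D F) (to_smash_morph D F)
  (@to_loc_surj V D F) (@to_smash_surj V D F)) => p q.
by rewrite to_loc_eq to_smash_eq.
Qed.
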